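(* Let $G=(V,E)$ be a finite graph of maximum degree $\Delta$ with no isolated vertices, and write $d_u$ for the degree of $u$. Let $b\in\{0\}\cup[1,\infty)$ and assume $\mathrm{mad}(G[N(u)])\le b$ for every $u\in V$. Set $c(0)=0.109597$ and, for $b\ge 1$, $c(b)=0.0896883/b$. Let $0<\lambda<c(b)/\Delta$ and for each $u\in V$ define \[ D_u := d_u(1+\lambda)^b\log(1+\lambda),\qquad \beta_u := \frac{1+\lambda}{\lambda}\cdot\frac{D_u}{W(D_u)(1+W(D_u))},\qquad \gamma_u := \frac{1+\lambda}{\lambda}\cdot\frac{D_u}{d_u(1+W(D_u))}. \] Then \[ \mathbb{E}_{G,\lambda\mathbf 1}|I| \;\ge\; \sum_{u\in V}\frac{1}{\beta_u+d_u\gamma_u}. \]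
   Context: The hard-core model on a graph $G=(V,E)$ with fugacity vector $\boldsymbol\lambda\in[0,\infty)^V$ is the probability measure on the set $\mathcal I(G)$ of independent sets with $\Pr_{G,\boldsymbol\lambda}(I)=\frac{1}{Z_G(\boldsymbol\lambda)}\prod_{v\in I}\lambda_v$, $Z_G(\boldsymbol\lambda)=\sum_{J\in\mathcal I(G)}\prod_{v\in J}\lambda_v$; $\mathbb{E}_{G,\boldsymbol\lambda}$ denotes expectation and $I$ the random independent set; $\lambda\mathbf 1$ is the constant vector with all entries $\lambda$. $N(u)$ is the neighborhood of $u$ and $G[N(u)]$ the induced subgraph. For a graph $H$, the maximum average degree is $\mathrm{mad}(H)=\max_{F\subseteq H,\,|V(F)|>0} 2|E(F)|/|V(F)|$ (maximum over subgraphs $F$); $\mathrm{mad}$ of the empty graph is taken as $0$. $W:(0,\infty)\to(0,\infty)$ is the principal branch of the Lambert $W$-function, i.e. the inverse of $x\mapsto xe^x$ on $(0,\infty)$. *)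

(* Defs.v *)
From HB Require Import structures.
From mathcomp Require Import all_boot all_order all_algebra.
From mathcomp Require Import all_classical all_reals all_analysis.
Set Implicit Arguments. Unset Strict Implicit. Unset Printing Implicit Defensive.
Import Order.TTheory GRing.Theory Num.Theory.
Local Open Scope ring_scope.

Section Defs.
Variable T : finType.
Variable e : rel T.

Definition simple_graph := symmetric e /\ irreflexive e.

Definition nbhd (u : T) : {set T} := [set v | e u v].
Definition deg (u : T) : nat := #|nbhd u|.
Definition max_deg : nat := \max_(u : T) deg u.

Definition edges_in (S : {set T}) : {set {set T}} :=
  [set E : {set T} | [exists x in S, exists y in S, e x y && (E == [set x; y])]].

(* maximum average degree of the induced subgraph G[A]:
   max over subgraphs F = (S, F) of G[A] with S nonempty of 2|F|/|S|;
   equals 0 when A is empty. *)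
Definition mad_induced (R : realType) (A : {set T}) : R :=
  \big[Num.max/0]_(S : {set T} | (S \subset A) && (S != finset.set0))
    \big[Num.max/0]_(F : {set {set T}} | F \subset edges_in S)
       ((2 * #|F|)%:R / #|S|%:R).

Definition indep (I : {set T}) : bool := [forall x in I, forall y in I, ~~ e x y].

Definition hc_Z (R : realType) (lam : R) : R :=
  \sum_(I : {set T} | indep I) lam ^+ #|I|.
Definition hc_exp_size (R : realType) (lam : R) : R :=
  (\sum_(I : {set T} | indep I) #|I|%:R * lam ^+ #|I|) / hc_Z lam.
End Defs.

(* principal branch of the Lambert W function on (0, oo):
   the unique w > 0 with w e^w = x *)
Definition lambertW (R : realType) (x : R) : R :=
  xget 0 [set w : R | 0 < w /\ w * expR w = x].

Definition hc_c (R : realType) (b : R) : R :=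
  if b == 0 then 109597%:R / 1000000%:R else (896883%:R / 10000000%:R) / b.

(* Main.v *)
(* Write q_u = ((1 + lam) / lam) P(u in I) and t = (1 + lam)^b ln(1 + lam).
   Conditioning on I outside N(u) and using Jensen's inequality gives
   q_u >= exp (- t sum_(v ~ u) q_v), and beta_u + d_u gamma_u is just
   (1 + lam) / lam * exp (W D_u); so the claim is sum q_u >= sum exp (- w_u),
   where w_u = W (t d_u).  The constraints on q are convex, and Lagrange
   multipliers are given by mu_u = exp (- w_u) / (1 + w_u), which are optimal for
   regular graphs.  Linearising the constraint at u once for each neighbour v and
   averaging over v leaves an error term that is a sum over the edges uv; each
   summand is nonnegative as soon as t * Delta <= 0.11, because mu is decreasing
   in the degree fast enough. *)
Require Import Defs.
From HB Require Import structures.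
From mathcomp Require Import all_boot all_order all_algebra.
From mathcomp Require Import all_classical all_reals all_analysis.
From mathcomp Require Import ring lra.
Set Implicit Arguments.
Unset Strict Implicit.
Unset Printing Implicit Defensive.
Import Order.TTheory GRing.Theory Num.Theory.
Import numFieldNormedType.Exports.
Local Open Scope ring_scope.
Local Open Scope classical_set_scope.

(** * Existence of the Lambert value *)

(** Since [expR x >= 1], the intermediate value theorem on [[0, x]] gives a root, so [xget] does not
    fall back on its default [0]. *)
Lemma lambertWP (R : realType) (x : R) :
  0 < x -> 0 < lambertW x /\ lambertW x * expR (lambertW x) = x.
Proof.
move=> x0; suff [w Hw] : exists w : R, 0 < w /\ w * expR w = x.
  by rewrite /lambertW;
    apply: (@xgetPex _ 0 [set w : R | 0 < w /\ w * expR w = x]%classic); exists w.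
have C : {within `[0, x]%classic, continuous (fun w : R => w * expR w)}.
  apply: continuous_subspaceT => z.
  by apply: cvgM; [exact: cvg_id|exact: continuous_expR].
have B : Num.min (0 * expR 0) (x * expR x) <= x <= Num.max (0 * expR 0) (x * expR x).
  rewrite mul0r ge_min le_max (ltW x0) /= ler_peMr ?orbT ?(ltW x0) //.
  by rewrite -expR0 ler_expR ltW.
have [w] := IVT (ltW x0) C B.
rewrite in_itv/= => /andP[w0 wx] E; exists w; split => //.
by rewrite lt_neqAle w0 andbT; apply/eqP => w0'; move: x0; rewrite -E -w0' mul0r ltxx.
Qed.

Local Close Scope classical_set_scope.

(** * The multipliers and the linearised constraint *)

Section Weights.
Variable R : realType.
Implicit Types w z : R.

(** The Lagrange multiplier at a vertex with Lambert value [w]; it is also the derivative of W at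
    [w * expR w]. *)
Definition lmu w := expR (- w) / (1 + w).

Lemma wexpR_small w : 0 <= w -> w * expR w <= 11 / 100 -> w <= 11 / 100.
Proof.
move=> w0; apply: le_trans; rewrite ler_peMr // -expR0 ler_expR //.
Qed.

Lemma lmu_gt0 w : 0 <= w -> 0 < lmu w.
Proof. by move=> w0; rewrite divr_gt0 ?expR_gt0 //; lra. Qed.

Lemma lmu_le1 w : 0 <= w -> lmu w <= 1.
Proof.
move=> w0; rewrite ler_pdivrMr ?mul1r; last by lra.
have : expR (- w) <= 1 by rewrite -expR0 ler_expR; lra.
lra.
Qed.

(** With [expR (- w) >= 1 - w] the constant 4/5 is valid up to w = 1/9. *)
Lemma lmu_ge w : 0 <= w -> w <= 11 / 100 -> 4 / 5 <= lmu w.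
Proof.
move=> w0 w1; rewrite ler_pdivlMr; last by lra.
have := expR_ge1Dx (- w); lra.
Qed.

(** A difference of reciprocals, as the inverse of [lmu w] is [expR w + w * expR w]. *)
Lemma lmu_sub w z : 0 <= w -> 0 <= z ->
  lmu w - lmu z =
  ((z * expR z - w * expR w) + (expR z - expR w)) * (lmu w * lmu z).
Proof.
move=> w0 z0; rewrite /lmu !expRN.
have ? := lt0r_neq0 (expR_gt0 w); have ? := lt0r_neq0 (expR_gt0 z).
have ? : 1 + w != 0 by apply: lt0r_neq0; lra.
have ? : 1 + z != 0 by apply: lt0r_neq0; lra.
by field; do ?[apply/andP; split].
Qed.

(** Convexity of s log s, with the tangent taken at s = [expR z]. *)
Lemma expR_sub_ge w z : 0 <= z ->
  z * expR z - w * expR w <= (1 + z) * (expR z - expR w).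
Proof.
move=> z0.
have : (1 + (z - w)) * expR w <= expR z.
  have -> : expR z = expR (z - w) * expR w by rewrite -expRD subrK.
  by rewrite ler_pM2r ?expR_gt0 // expR_ge1Dx.
lra.
Qed.

(** With m = [lmu w] and n = [lmu z], clearing denominators leaves y m^2 - x n^2 <= m - n. It holds
    because [lmu] drops by at least (19/10) m n per unit of [w * expR w]. *)
Lemma lmu_pair_le w z (x := w * expR w) (y := z * expR z) :
  0 <= w -> 0 <= z -> y <= 11 / 100 -> w <= z ->
  lmu z / (1 - y * lmu w) <= lmu w / (1 - x * lmu z).
Proof.
move=> w0 z0 y1 wz.
have z1 := wexpR_small z0 y1.
have xy : x <= y by rewrite ler_pM ?expR_ge0 ?ler_expR.
have x0 : 0 <= x by rewrite mulr_ge0 ?expR_ge0.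
have m1 := lmu_le1 w0; have n1 := lmu_le1 z0.
have m0 := lmu_gt0 w0; have n0 := lmu_gt0 z0.
have ng := lmu_ge z0 z1.
have den (a c : R) : 0 <= a -> a <= 11/100 -> 0 < c -> c <= 1 -> 0 < 1 - a * c.
  move=> a0 a1 c0 c1; have : a * c <= a by rewrite ler_piMr.
  lra.
rewrite ler_pdivrMr ?den //; last by lra.
rewrite mulrAC ler_pdivlMr ?den //; last by lra.
have S := lmu_sub w0 z0; have Eg := expR_sub_ge w z0.
move: S Eg; rewrite -/x -/y.
set m := lmu w in m0 m1 *; set n := lmu z in n0 n1 ng *; set k := expR z - expR w.
move=> S Eg.
have k0 : 0 <= k by rewrite subr_ge0 ler_expR.
clearbody m n k.
have k1 : (9 / 10) * (y - x) <= k.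
  have : (1 + z) * k <= 111 / 100 * k by rewrite ler_wpM2r //; lra.
  lra.
have mn : (19 / 10) * (y - x) * (m * n) <= m - n.
  by rewrite S ler_pM2r; [lra|exact: mulr_gt0].
have mn0 : 0 <= m - n by apply: le_trans mn; rewrite !mulr_ge0 //; lra.
(* The left side is split as (y - x) m^2 + x (m - n)(m + n), and the two shares 78/100 and 22/100
   add up to 1. The second is x (m + n) <= 2 * 11/100; the first has room, since n >= 4/5 already
   gives (5/4) / (19/10). *)
have A : (y - x) * m ^+ 2 <= (78 / 100) * (m - n).
  apply: (@le_trans _ _ ((y - x) * m)).
    by rewrite expr2 mulrA ler_piMr // mulr_ge0 //; lra.
  have : (y - x) * m * (4/5) <= (y - x) * m * n by rewrite ler_wpM2l // mulr_ge0 //; lra.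
  have : 0 <= (y - x) * m by rewrite mulr_ge0 //; lra.
  move: mn; rewrite mulrA -(mulrA (19/10)) -(mulrA (19/10)); lra.
have B : x * (m - n) * (m + n) <= (22 / 100) * (m - n).
  have -> : x * (m - n) * (m + n) = (x * (m + n)) * (m - n) by ring.
  rewrite ler_wpM2r //; nra.
have -> : n * (1 - x * n) = n - x * n ^+ 2 by ring.
have -> : m * (1 - y * m) = m - y * m ^+ 2 by ring.
have : y * m ^+ 2 - x * n ^+ 2 = (y - x) * m ^+ 2 + x * (m - n) * (m + n) by ring.
lra.
Qed.

(** The two error terms of an edge combine into a product of two differences, which have the same
    sign by monotonicity of [lmu] and [lmu_pair_le]. *)
Lemma lmu_pair w z (x := w * expR w) (y := z * expR z) :
  0 <= w -> 0 <= z -> x <= 11 / 100 -> y <= 11 / 100 ->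
  0 <= lmu w * (lmu w - lmu z) / (1 - x * lmu z)
     + lmu z * (lmu z - lmu w) / (1 - y * lmu w).
Proof.
move=> w0 z0 x1 y1.
have H a c : 0 <= a -> 0 <= c -> c * expR c <= 11 / 100 -> a <= c ->
    0 <= lmu a - lmu c.
  move=> a0 c0 c1 ac; rewrite lmu_sub // mulr_ge0 //; last first.
    by rewrite mulr_ge0 // ltW // lmu_gt0.
  by rewrite addr_ge0 // subr_ge0 ?ler_expR // ler_pM ?expR_ge0 ?ler_expR.
have -> : lmu w * (lmu w - lmu z) / (1 - x * lmu z)
     + lmu z * (lmu z - lmu w) / (1 - y * lmu w) =
  (lmu w - lmu z) * (lmu w / (1 - x * lmu z) - lmu z / (1 - y * lmu w)) by ring.
have [wz|/ltW zw] := leP w z.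
  by rewrite mulr_ge0 ?H // subr_ge0 lmu_pair_le.
by rewrite -mulrNN !opprB mulr_ge0 ?H // subr_ge0 lmu_pair_le.
Qed.

(* The bound [q >= expR (- s)] is linearised at the tangent point
   [lmu w / (1 - x m)], the optimal one for a neighbour of weight [m]. *)
Lemma tangent_bound w (q s m : R) (x := w * expR w) :
  0 <= w -> x * m < 1 -> expR (- s) <= q ->
  expR (- w) + lmu w * (x * (lmu w - m) / (1 - x * m))
    <= (1 - x * m) * q + lmu w * s.
Proof.
move=> w0 xm qs.
have d0 : 0 < 1 - x * m by lra.
have w1 : 0 < 1 + w by lra.
have ew := lt0r_neq0 (expR_gt0 w); have nw := lt0r_neq0 w1; have nd := lt0r_neq0 d0.
(* [rho] is [expR (- w)] divided by the tangent point. *)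
pose rho := (1 - x * m) * (1 + w).
have rho0 : 0 < rho by rewrite mulr_gt0.
have nr := lt0r_neq0 rho0.
have xE : x * (lmu w - m) / (1 - x * m) = 1 - rho^-1.
  rewrite /rho /lmu expRN.
  have -> : x * ((expR w)^-1 / (1 + w) - m) = (1 - x * m) - (1 + w)^-1.
    by rewrite /x; field; do ?[apply/andP; split].
  by field; do ?[apply/andP; split].
(* This is log rho >= 1 - 1/rho; it replaces the logarithm from the exact tangent by the rational
   error term. *)
have rE : expR (1 - rho^-1) <= rho.
  rewrite -[leRHS]invrK -(opprB rho^-1) expRN lef_pV2 ?posrE ?expR_gt0 ?invr_gt0 //.
  by have := expR_ge1Dx (rho^-1 - 1); lra.
have key : 1 + (w - s + (1 - rho^-1)) <= q * expR w * rho.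
  apply: le_trans (expR_ge1Dx _) _; rewrite (expRD (w - s)) (expRD w).
  rewrite (mulrC (expR w)); apply: ler_pM; rewrite ?mulr_ge0 ?expR_ge0 //.
  by rewrite ler_pM2r ?expR_gt0.
have -> : (1 - x * m) * q = lmu w * (q * expR w * rho).
  by rewrite /lmu /rho expRN; field; do ?[apply/andP; split].
rewrite xE.
have -> : expR (- w) = lmu w * (1 + w) by rewrite /lmu; field.
rewrite -!mulrDr ler_pM2l ?lmu_gt0 //; lra.
Qed.

End Weights.
Arguments lmu {R}.

(** * From local constraints to a bound on the sum *)

Lemma sum_nbhdC (R : realType) (T : finType) (e : rel T) (f : T -> T -> R) :
  symmetric e ->
  \sum_u \sum_(v in nbhd e u) f u v = \sum_u \sum_(v in nbhd e u) f v u.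
Proof.
move=> se; rewrite (exchange_big_dep predT) //=; apply: eq_bigr => v _.
by apply: eq_bigl => u; rewrite !inE se.
Qed.

Lemma sum_fixpoint_bound (R : realType) (T : finType) (e : rel T) (t : R)
    (q w : T -> R) :
  symmetric e -> (forall u, (0 < deg e u)%N) ->
  (forall u, t * (deg e u)%:R <= 11 / 100) ->
  (forall u, 0 <= w u) -> (forall u, w u * expR (w u) = t * (deg e u)%:R) ->
  (forall u, expR (- (t * \sum_(v in nbhd e u) q v)) <= q u) ->
  \sum_u expR (- w u) <= \sum_u q u.
Proof.
move=> se d0 td w0 wE qb.
pose x u := w u * expR (w u); pose m u := lmu (w u).
pose g u v := m u * (m u - m v) / (1 - x u * m v).
have x1 u : x u <= 11 / 100 by rewrite /x wE.
have x0 u : 0 <= x u by rewrite mulr_ge0 ?expR_ge0.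
have xm u v : x u * m v < 1.
  have := lmu_le1 (w0 v); have := lmu_gt0 (w0 v); have := x1 u; have := x0 u.
  rewrite -/(m v) => ? ? ? ?; have : x u * m v <= x u by rewrite ler_piMr.
  lra.
(* The sign of [t] is read off at a vertex; on an empty graph the error sum vanishes anyway. *)
have t0 (u : T) : 0 <= t.
  by have := x0 u; rewrite /x wE pmulr_lge0 // ltr0n.
(* Average over the neighbours v of [tangent_bound] with multiplier [m v]; dividing [x u] by the
   degree leaves [t]. *)
have H u : expR (- w u) + t * \sum_(v in nbhd e u) g u v <=
    q u - t * \sum_(v in nbhd e u) m v * q u
        + t * \sum_(v in nbhd e u) m u * q v.
  have du : 0 < (deg e u)%:R :> R by rewrite ltr0n.
  rewrite -(ler_pM2l du) -subr_ge0.
  pose F v := (1 - x u * m v) * q u + m u * (t * \sum_(v in nbhd e u) q v)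
     - (expR (- w u) + m u * (x u * (m u - m v) / (1 - x u * m v))).
  have : 0 <= \sum_(v in nbhd e u) F v.
    apply: sumr_ge0 => v _; rewrite subr_ge0; apply: tangent_bound;
      [exact: w0|exact: xm|exact: qb].
  suff -> : \sum_(v in nbhd e u) F v =
    (deg e u)%:R * (q u - t * \sum_(v in nbhd e u) m v * q u
        + t * \sum_(v in nbhd e u) m u * q v) -
    (deg e u)%:R * (expR (- w u) + t * \sum_(v in nbhd e u) g u v) by [].
  have sc c : \sum_(v in nbhd e u) (c : R) = (deg e u)%:R * c.
    by rewrite sumr_const mulr_natl.
  rewrite -mulr_sumr.
  have -> : \sum_(v in nbhd e u) F v = \sum_(v in nbhd e u)
      (q u - t * (deg e u)%:R * (m v * q u) + m u * (t * \sum_(v in nbhd e u) q v)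
       - (expR (- w u) + t * (deg e u)%:R * g u v)).
    apply: eq_bigr => v _; rewrite /F /g -wE -/(x u); ring.
  rewrite sumrB !big_split /= sumrN -!mulr_sumr !sc; ring.
have : \sum_u (expR (- w u) + t * \sum_(v in nbhd e u) g u v) <= _ :=
  ler_sum _ (fun u _ => H u).
(* Summed over all vertices, the terms linear in [q] cancel by symmetry of adjacency. *)
rewrite !big_split /= sumrN -!mulr_sumr (sum_nbhdC (fun u v => m v * q u) se) subrK.
apply: le_trans; rewrite lerDl.
case: (pickP (fun _ : T => true)) => [u _|T0]; last by rewrite big_pred0 // mulr0.
rewrite mulr_ge0 ?(t0 u) //.
(* Doubling lets each error term [g u v] be paired with [g v u]. *)
suff : 0 <= 2 * \sum_u \sum_(v in nbhd e u) g u v by rewrite pmulr_rge0.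
rewrite mulr2n mulrDl mul1r {1}(sum_nbhdC g se) -big_split /=.
apply: sumr_ge0 => {}u _; rewrite -big_split /=; apply: sumr_ge0 => v _.
exact: lmu_pair (w0 v) (w0 u) (x1 v) (x1 u).
Qed.

(** * Partition functions of induced subgraphs *)

Section HardCore.
Variables (R : realType) (T : finType) (e : rel T) (lam : R).
Hypotheses (se : symmetric e) (ie : irreflexive e) (lam0 : 0 < lam).
Implicit Types (A B I J K S : {set T}) (u v y : T).

Definition hc_Zin A : R := \sum_(I : {set T} | indep e I && (I \subset A)) lam ^+ #|I|.
(** The unnormalised expected size: divided by [hc_Zin A] it is the mean for the model on the
    subgraph induced by [A]. *)
Definition hc_size_in A : R :=
  \sum_(I : {set T} | indep e I && (I \subset A)) #|I|%:R * lam ^+ #|I|.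

Lemma indepP I : reflect {in I &, forall x y, ~~ e x y} (indep e I).
Proof.
apply: (iffP forall_inP) => H.
  by move=> x y xI; move/(_ x xI): H => /forall_inP; exact.
by move=> x xI; apply/forall_inP => y; exact: H.
Qed.

Lemma indep_sub I J : J \subset I -> indep e I -> indep e J.
Proof.
move=> /fintype.subsetP JI /indepP H; apply/indepP => x y /JI ? /JI ?; exact: H.
Qed.

Lemma indepU I J : indep e (I :|: J) =
  [&& indep e I, indep e J & [forall x in I, J \subset ~: nbhd e x]].
Proof.
apply/indepP/and3P => [H|[/indepP HI /indepP HJ /forall_inP HIJ]].
  split.
  - by apply/indepP => x y xI yI; apply: H; rewrite inE ?xI ?yI.
  - by apply/indepP => x y xI yI; apply: H; rewrite inE ?xI ?yI orbT.
  - apply/forall_inP => x xI; apply/fintype.subsetP => y yJ.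
    by rewrite !inE; apply: H; rewrite inE ?xI ?yJ ?orbT.
have X x y : x \in I -> y \in J -> ~~ e x y.
  by move=> xI yJ; move: (HIJ x xI) => /fintype.subsetP /(_ y yJ); rewrite !inE.
move=> x y /finset.setUP[] xI /finset.setUP[] yI.
- exact: HI.
- exact: X.
- by rewrite se X.
- exact: HJ.
Qed.

Lemma indep1 y : indep e [set y].
Proof. by apply/indepP => a c; rewrite !inE => /eqP-> /eqP->; rewrite ie. Qed.

Lemma hc_Zin_setT : hc_Zin [set: T] = hc_Z e lam.
Proof. by apply: eq_bigl => I; rewrite finset.subsetT andbT. Qed.

Lemma hc_Zin_ge1 A : 1 <= hc_Zin A.
Proof.
rewrite /hc_Zin (bigD1 finset.set0) /=; last first.
  by rewrite finset.sub0set andbT; apply/indepP => x y; rewrite inE.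
by rewrite cards0 expr0 lerDl sumr_ge0 // => I _; rewrite exprn_ge0 // ltW.
Qed.

Lemma hc_Zin_gt0 A : 0 < hc_Zin A.
Proof. exact: lt_le_trans (hc_Zin_ge1 A). Qed.

Lemma hc_Zin_le A B : A \subset B -> hc_Zin A <= hc_Zin B.
Proof.
move=> AB; rewrite /hc_Zin [leRHS](bigID (fun I => I \subset A)) /=.
rewrite -[leLHS]addr0 lerD //.
  rewrite le_eqVlt; apply/orP; left; apply/eqP; apply: eq_bigl => I.
  case: (boolP (I \subset A)) => IA; rewrite ?andbF ?andbT //.
  by rewrite (fintype.subset_trans IA AB) andbT.
by apply: sumr_ge0 => I _; rewrite exprn_ge0 // ltW.
Qed.

(** Removing [y] is a bijection onto the independent sets that avoid its closed neighbourhood. *)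
Lemma hc_occ y A : y \in A ->
  \sum_(I : {set T} | indep e I && (I \subset A) && (y \in I)) lam ^+ #|I| =
  lam * hc_Zin (A :\: (y |: nbhd e y)).
Proof.
move=> yA; rewrite /hc_Zin mulr_sumr.
rewrite (reindex_onto (fun K => y |: K) (fun I => I :\ y)) /=; last first.
  by move=> I /andP[_ yI]; rewrite finset.setD1K.
apply: eq_big => K.
  rewrite indepU indep1 finset.subUset finset.sub1set yA setU11 andbT /=.
  have -> : [forall x in [set y], K \subset ~: nbhd e x] = (K \subset ~: nbhd e y).
    apply/forall_inP/idP => [H|H x]; first by apply: H; rewrite inE.
    by rewrite inE => /eqP ->.
  have -> : ((y |: K) :\ y == K) = (y \notin K).
    apply/eqP/idP => [<-|]; [by rewrite !inE eqxx|exact: setU1K].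
  rewrite finset.subsetD finset.disjoints_subset finset.setCU finset.subsetI
    (finset.subsetC K [set y]).
  rewrite finset.sub1set !inE.
  by case: (indep e K); case: (K \subset A); case: (K \subset _); case: (y \in K).
by move=> /andP[_ /eqP H]; rewrite cardsU1 -[in y \notin K]H !inE eqxx exprS.
Qed.

Lemma hc_Zin_split y A : y \in A ->
  hc_Zin A = lam * hc_Zin (A :\: (y |: nbhd e y)) + hc_Zin (A :\ y).
Proof.
move=> yA; rewrite -hc_occ // {1}/hc_Zin (bigID (fun I : {set T} => y \in I)) /=.
congr (_ + _); apply: eq_bigl => I.
by rewrite finset.subsetD1 andbA.
Qed.

(** Induction on [B]: in the deletion recursion the set multiplied by [lam] lies inside the other
    one, so each vertex costs a factor of at most [1 + lam]. *)
Lemma hc_Zin_setD A B : hc_Zin A <= (1 + lam) ^+ #|B| * hc_Zin (A :\: B).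
Proof.
have [n] := ubnP #|B|; elim: n B => // n IH B Bn.
have [->|[y yB]] := finset.set_0Vmem B; first by rewrite cards0 expr0 mul1r finset.setD0.
apply: le_trans (IH (B :\ y) _) _; first by rewrite (cardsD1 y B) yB in Bn.
rewrite (cardsD1 y B) yB exprS mulrAC [leRHS]mulrC ler_wpM2l //.
  by rewrite exprn_ge0 // addr_ge0 // ltW.
have [yA|yA] := boolP (y \in A :\: (B :\ y)); last first.
  rewrite [X in hc_Zin X <= _](_ : _ = A :\: B).
    by rewrite ler_peMl ?lerDl // ltW // hc_Zin_gt0.
  apply/finset.setP => x; move: yA; rewrite !inE eqxx /= => yA.
  by case: eqVneq => // ->; rewrite yB (negPf yA).
have E : A :\: (B :\ y) :\ y = A :\: B.
  apply/finset.setP => x; rewrite !inE.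
  by case: eqVneq => // ->; rewrite yB.
rewrite (hc_Zin_split yA) E mulrDl mul1r addrC lerD2l ler_pM2l //.
by rewrite -E hc_Zin_le // finset.setDS // finset.subsetUl.
Qed.

Lemma hc_Zin_le_exp A : hc_Zin A <= (1 + lam) ^+ #|A|.
Proof.
apply: le_trans (hc_Zin_setD A A) _.
rewrite finset.setDv /hc_Zin (big_pred1 finset.set0).
  by rewrite cards0 expr0 mulr1.
move=> I; rewrite finset.subset0 /=; case: eqP => [->|]; rewrite ?andbF ?andbT //.
by apply/indepP => x y; rewrite inE.
Qed.

(** * Expected size under an average degree bound, and splitting along a set *)

Lemma hc_size_in_occ A : hc_size_in A =
  \sum_(y in A) \sum_(I : {set T} | indep e I && (I \subset A) && (y \in I)) lam ^+ #|I|.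
Proof.
rewrite /hc_size_in (exchange_big_dep (fun I => indep e I && (I \subset A))) /=; last first.
  by move=> y I _ /andP[].
apply: eq_bigr => I /andP[iI IA].
rewrite sumr_const mulr_natl; congr (_ *+ _); apply: eq_card => y.
rewrite [RHS]/in_mem /= iI IA /=; case yI : (y \in I); rewrite ?andbF //.
by rewrite (fintype.subsetP IA _ yI).
Qed.

(** Ordered adjacent pairs in [S] map to edges with fibres of size at most two. *)
Lemma handshake S :
  (\sum_(y in S) #|nbhd e y :&: S| <= 2 * #|edges_in e S|)%N.
Proof.
pose P := [set p : T * T | [&& p.1 \in S, p.2 \in S & e p.1 p.2]].
have -> : (\sum_(y in S) #|nbhd e y :&: S| = #|P|)%N.
  transitivity (\sum_(p in P) 1)%N; last by rewrite sum1_card.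
  rewrite (eq_bigl (fun p : T * T => (p.1 \in S) && ((p.2 \in nbhd e p.1 :&: S)))); last first.
    by case=> x y; rewrite !inE /= [e x y && _]andbC.
  rewrite -(pair_big_dep (fun x => x \in S) (fun x y => y \in nbhd e x :&: S) (fun _ _ => 1%N)) /=.
  by apply: eq_bigr => x _; rewrite sum1_card.
rewrite -sum1_card (partition_big (fun p : T * T => [set p.1; p.2]) (mem (edges_in e S))) /=.
  rewrite mulnC -sum_nat_const; apply: leq_sum => E /=.
  rewrite inE => /exists_inP[x _] /exists_inP[y _] /andP[_ /eqP ->].
  rewrite sum1_card; apply: (@leq_trans #|[set (x, y); (y, x)]|).
    apply: subset_leq_card; apply/fintype.subsetP => -[a c]; rewrite !inE /=.
    case/andP=> _ /eqP /= H.
    have := finset.set21 a c; have := finset.set22 a c; rewrite H.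
    have := finset.set21 x y; have := finset.set22 x y; rewrite -{1 2}H.
    rewrite !inE !xpair_eqE (eq_sym x a) (eq_sym x c) (eq_sym y a) (eq_sym y c).
    by case: (a == x); case: (a == y); case: (c == x); case: (c == y).
  by rewrite cards2; case: (_ != _).
case=> x y; rewrite !inE /= => /and3P[xS yS exy].
by apply/exists_inP; exists x => //; apply/exists_inP; exists y => //; rewrite exy eqxx.
Qed.

(** A nonempty [S] with all its edges is one of the subgraphs over which the maximum is taken. *)
Lemma mad_edges S A (b : R) : S \subset A -> mad_induced e R A <= b ->
  (\sum_(y in S) #|nbhd e y :&: S|)%:R <= b * #|S|%:R.
Proof.
move=> SA; have [->|[x xS]] := finset.set_0Vmem S.
  by rewrite big_set0 cards0 mulr0.
have S0 : (0 < #|S|)%N by apply/card_gt0P; exists x.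
move=> mb; rewrite -ler_pdivrMr ?ltr0n //; apply: le_trans mb.
have Sn : (S \subset A) && (S != finset.set0).
  by rewrite SA; apply/finset.set0Pn; exists x.
apply: (bigmax_sup S) => //; apply: (bigmax_sup (edges_in e S)) => //.
by rewrite ler_pM2r ?invr_gt0 ?ltr0n // ler_nat handshake.
Qed.

(* Tangent line of [d |-> expR (- s d)] at the average degree bound [b]. *)
Lemma hc_size_in_ge S A (b : R) (s := ln (1 + lam)) :
  S \subset A -> mad_induced e R A <= b ->
  lam / (1 + lam) * expR (- (s * b)) * #|S|%:R * hc_Zin S <= hc_size_in S.
Proof.
move=> SA /(mad_edges SA) mb.
have l1 : 0 < 1 + lam by rewrite addr_gt0.
have s0 : 0 <= s by rewrite ln_ge0 // lerDl ltW.
have le1 y : y \in S ->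
    lam / (1 + lam) * hc_Zin S * (expR (- (s * b)) * (1 - s * (#|nbhd e y :&: S|%:R - b))) <=
    \sum_(I : {set T} | indep e I && (I \subset S) && (y \in I)) lam ^+ #|I|.
  move=> yS; rewrite hc_occ // -!mulrA ler_pM2l //.
  have Zle : hc_Zin S <= (1 + lam) * expR (s * #|nbhd e y :&: S|%:R) *
      hc_Zin (S :\: (y |: nbhd e y)).
    (* Only neighbours inside [S] are removed, so the cost is one factor [1 + lam] for [y] and one
       for each of them. *)
    have -> : S :\: (y |: nbhd e y) = S :\: (y |: (nbhd e y :&: S)).
      apply/finset.setP => x; rewrite !inE.
      by case: (x \in S); rewrite ?andbF ?andbT.
    apply: le_trans (hc_Zin_setD S (y |: (nbhd e y :&: S))) _.
    by rewrite cardsU1 !inE ie /= exprS expRM_natr lnK.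
  rewrite ler_pdivrMl //.
  have E1 : expR (- (s * b)) * (1 - s * (#|nbhd e y :&: S|%:R - b)) <=
      expR (- (s * #|nbhd e y :&: S|%:R)).
    rewrite (_ : - (s * #|nbhd e y :&: S|%:R) =
       - (s * b) + - (s * (#|nbhd e y :&: S|%:R - b))); last by ring.
    by rewrite expRD ler_pM2l ?expR_gt0 // expR_ge1Dx.
  apply: le_trans (_ : _ <= hc_Zin S * expR (- (s * #|nbhd e y :&: S|%:R))) _.
    by rewrite ler_pM2l ?hc_Zin_gt0.
  rewrite expRN ler_pdivrMr ?expR_gt0 // mulrAC; exact: Zle.
rewrite hc_size_in_occ; apply: le_trans (ler_sum _ le1).
rewrite -mulr_sumr -mulr_sumr.
(* The tangent line makes the bound linear in the degrees, so only their sum matters, and [mb]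
   controls it. *)
have -> : \sum_(y in S) (1 - s * (#|nbhd e y :&: S|%:R - b)) =
    #|S|%:R + s * (b * #|S|%:R - (\sum_(y in S) #|nbhd e y :&: S|)%:R).
  rewrite sumrB -mulr_sumr sumrB !sumr_const -(mulr_natr b) natr_sum; ring.
rewrite -!mulrA ler_pM2l // ler_pM2l ?invr_gt0 //.
rewrite [leRHS]mulrCA ler_pM2l ?expR_gt0 // mulrC ler_pM2l ?hc_Zin_gt0 //.
by rewrite lerDl mulr_ge0 // subr_ge0.
Qed.

(* Independent sets sorted by their trace [J] outside [S]: the trace on [S] is
   then an arbitrary independent subset of [hc_free S J]. *)
Definition hc_free S J : {set T} := [set v in S | [disjoint nbhd e v & J]].

(** [f] is kept general: constant 1 gives the partition function, the cast to [R] the expected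
    number of chosen vertices in [S]. *)
Lemma hc_sum_split S (f : nat -> R) :
  \sum_(I : {set T} | indep e I) f #|I :&: S| * lam ^+ #|I| =
  \sum_(J : {set T} | indep e J && (J \subset ~: S)) lam ^+ #|J| *
    \sum_(K : {set T} | indep e K && (K \subset hc_free S J)) f #|K| * lam ^+ #|K|.
Proof.
rewrite (partition_big (fun I => I :\: S)
  (fun J => indep e J && (J \subset ~: S))) /=; last first.
  by move=> I iI; rewrite (indep_sub (finset.subsetDl I S) iI) finset.setDE finset.subsetIr.
apply: eq_bigr => J /andP[iJ JS].
rewrite mulr_sumr (reindex_onto (fun K => K :|: J) (fun I => I :&: S)) /=; last first.
  by move=> I /andP[_ /eqP <-]; rewrite finset.setUC finset.setDE
    finset.setUC -finset.setIUr finset.setUCr finset.setIT.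
have JS0 : J :&: S = finset.set0.
  by apply/eqP; rewrite finset.setI_eq0 finset.disjoints_subset.
have JSD : J :\: S = J by rewrite finset.setDE; apply/finset.setIidPl.
apply: eq_big => K.
  rewrite indepU iJ /= finset.setIUl JS0 finset.setU0 finset.setDUl JSD.
  have -> : (K :&: S == K) = (K \subset S) by apply/eqP/finset.setIidPl.
  have [KS|KS] := boolP (K \subset S); last first.
    rewrite andbF; apply/esym/negbTE; apply: contra KS => /andP[_ H].
    by apply: (fintype.subset_trans H); apply/fintype.subsetP => x; rewrite inE => /andP[].
  have -> : K :\: S = finset.set0 by apply/eqP; rewrite finset.setD_eq0.
  rewrite finset.set0U eqxx !andbT; congr (_ && _).
  apply/forall_inP/fintype.subsetP => H x xK.
    rewrite inE (fintype.subsetP KS) //= disjoint_sym finset.disjoints_subset; exact: H.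
  by have := H x xK; rewrite inE => /andP[_]; rewrite disjoint_sym finset.disjoints_subset.
move=> /andP[_ /eqP KE].
rewrite mulrCA -exprD [in f _]KE; congr (_ * lam ^+ _).
have KS : K \subset S by rewrite -KE finset.subsetIr.
have /eqP KJ : K :&: J == finset.set0.
  rewrite finset.setI_eq0 disjoint_sym finset.disjoints_subset.
  by apply: fintype.subset_trans JS _; rewrite finset.setCS.
by rewrite cardsU KJ cards0 subn0 addnC.
Qed.

(** * Occupancy probabilities and the local inequality *)

Definition hc_occupancy u : R :=
  (\sum_(I : {set T} | indep e I && (u \in I)) lam ^+ #|I|) / hc_Z e lam.

Lemma hc_exp_size_occ : hc_exp_size e lam = \sum_u hc_occupancy u.
Proof.
rewrite /hc_exp_size /hc_occupancy -mulr_suml; congr (_ / _).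
rewrite (exchange_big_dep (fun I : {set T} => indep e I)) /=; last by move=> y I _ /andP[].
apply: eq_bigr => I iI.
rewrite sumr_const mulr_natl; congr (_ *+ _); apply: eq_card => y.
by rewrite [RHS]/in_mem /= iI.
Qed.

Lemma hc_Z_gt0 : 0 < hc_Z e lam.
Proof. by rewrite -hc_Zin_setT hc_Zin_gt0. Qed.

(** Once its neighbours are all unoccupied, [u] is occupied with probability [lam / (1 + lam)]. *)
Lemma hc_occupancy_avoid u :
  hc_occupancy u = lam / (1 + lam) *
   ((\sum_(J : {set T} | indep e J && (J \subset ~: nbhd e u)) lam ^+ #|J|) / hc_Z e lam).
Proof.
have uA : u \in ~: nbhd e u by rewrite !inE ie.
have l1 : 1 + lam != 0 by rewrite gt_eqF // addr_gt0.
rewrite -/(hc_Zin _) (hc_Zin_split uA) /hc_occupancy.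
have -> : (\sum_(I : {set T} | indep e I && (u \in I)) lam ^+ #|I|) =
   lam * hc_Zin (~: (u |: nbhd e u)).
  rewrite -finset.setTD -hc_occ ?inE //; apply: eq_bigl => I.
  by rewrite finset.subsetT andbT.
have -> : ~: nbhd e u :\: (u |: nbhd e u) = ~: (u |: nbhd e u).
  by apply/finset.setP => x; rewrite !inE; case: (x == u); case: (e u x).
have -> : ~: nbhd e u :\ u = ~: (u |: nbhd e u).
  by apply/finset.setP => x; rewrite !inE; case: (x == u); case: (e u x).
have ? := lt0r_neq0 hc_Z_gt0.
by field; apply/andP.
Qed.

(** [q u] is the probability that N(u) is unoccupied. Given the trace J outside N(u), with free set
    F, this is 1 / [hc_Zin F] >= (1 + lam)^(-|F|); Jensen then needs an upper bound on the mean of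
    |F|. *)
Lemma hc_local_bound u (b : R) (s := ln (1 + lam))
    (q := fun v => (1 + lam) / lam * hc_occupancy v) :
  mad_induced e R (nbhd e u) <= b ->
  expR (- (s * expR (s * b) * \sum_(v in nbhd e u) q v)) <= q u.
Proof.
move=> mb; set S := nbhd e u; set m := expR (s * b) * \sum_(v in S) q v.
have l1 : 0 < 1 + lam by rewrite addr_gt0.
have l1n := lt0r_neq0 l1; have ln0 := lt0r_neq0 lam0.
have s0 : 0 <= s by rewrite ln_ge0 // lerDl ltW.
have Z0 := hc_Z_gt0; have Zn := lt0r_neq0 Z0.
rewrite -mulrA -/m.
have -> : q u = (\sum_(J : {set T} | indep e J && (J \subset ~: S)) lam ^+ #|J|) / hc_Z e lam.
  by rewrite /q hc_occupancy_avoid -/S; field; rewrite Zn ln0 l1n.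
(* By [hc_size_in_ge], [c] bounds from below the expected number of occupied vertices per free
   vertex. *)
pose F J := hc_free S J; pose c := lam / (1 + lam) * expR (- (s * b)).
have c0 : 0 < c by rewrite !mulr_gt0 ?invr_gt0 ?expR_gt0.
have FS J : F J \subset S by apply/fintype.subsetP => x; rewrite inE => /andP[].
have ZE : hc_Z e lam =
    \sum_(J : {set T} | indep e J && (J \subset ~: S)) lam ^+ #|J| * hc_Zin (F J).
  transitivity (\sum_(I : {set T} | indep e I) (fun=> 1) #|I :&: S| * lam ^+ #|I|).
    by apply: eq_bigr => I _; rewrite mul1r.
  rewrite (hc_sum_split S (fun=> 1)); apply: eq_bigr => J _; congr (_ * _).
  by apply: eq_bigr => K _; rewrite mul1r.
have NE : hc_Z e lam * \sum_(v in S) hc_occupancy v =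
    \sum_(J : {set T} | indep e J && (J \subset ~: S)) lam ^+ #|J| * hc_size_in (F J).
  rewrite /hc_occupancy -mulr_suml mulrC divfK //.
  rewrite -(hc_sum_split S (fun n => n%:R)).
  rewrite (exchange_big_dep (fun I : {set T} => indep e I)) /=; last by move=> y I _ /andP[].
  apply: eq_bigr => I iI.
  rewrite sumr_const mulr_natl; congr (_ *+ _); apply: eq_card => y.
  by rewrite [RHS]finset.in_setI [LHS]/in_mem /= iI /= andbC.
have mE : hc_Z e lam * m * c = hc_Z e lam * \sum_(v in S) hc_occupancy v.
  rewrite /m /c /q -mulr_sumr expRN; have ? := lt0r_neq0 (expR_gt0 (s * b)).
  by field; do ?[apply/andP; split].
(* The mean of |F| is at most [m]. *)
have XE : \sum_(J : {set T} | indep e J && (J \subset ~: S))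
     lam ^+ #|J| * (hc_Zin (F J) * #|F J|%:R) <= hc_Z e lam * m.
  rewrite -(ler_pM2r c0) mE NE mulr_suml; apply: ler_sum => J _.
  rewrite -mulrA ler_pM2l ?exprn_gt0 // mulrC mulrA mulrAC.
  exact: hc_size_in_ge (FS J) mb.
rewrite ler_pdivlMr //.
(* Jensen by hand: the tangent of exp(-s d) is taken at d = [m], and its slope is nonpositive, so a
   mean below [m] suffices. *)
apply: le_trans (_ : _ <= expR (- (s * m)) * \sum_(J : {set T} | indep e J && (J \subset ~: S))
     lam ^+ #|J| * (hc_Zin (F J) * (1 - s * (#|F J|%:R - m)))) _.
  rewrite ler_pM2l ?expR_gt0 //.
  have -> : \sum_(J : {set T} | indep e J && (J \subset ~: S))
     lam ^+ #|J| * (hc_Zin (F J) * (1 - s * (#|F J|%:R - m))) =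
     hc_Z e lam + s * (hc_Z e lam * m - \sum_(J : {set T} | indep e J && (J \subset ~: S))
     lam ^+ #|J| * (hc_Zin (F J) * #|F J|%:R)).
    rewrite {1 2}ZE mulr_suml -sumrB mulr_sumr -big_split /=.
    by apply: eq_bigr => J _; ring.
  by rewrite lerDl mulr_ge0 // subr_ge0.
rewrite mulr_sumr; apply: ler_sum => J _.
rewrite mulrCA ler_piMr ?exprn_ge0 ?(ltW lam0) //.
have : hc_Zin (F J) <= expR (s * #|F J|%:R).
  apply: le_trans (hc_Zin_le_exp _) _.
  by rewrite expRM_natr lnK.
move=> ZF; apply: le_trans (_ : _ <= hc_Zin (F J) * expR (- (s * #|F J|%:R))) _.
  rewrite mulrCA ler_pM2l ?hc_Zin_gt0 //.
  rewrite (_ : - (s * #|F J|%:R) = - (s * m) + - (s * (#|F J|%:R - m))); last by ring.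
  by rewrite expRD ler_pM2l ?expR_gt0 // expR_ge1Dx.
by rewrite expRN ler_pdivrMr ?expR_gt0 // mul1r.
Qed.
End HardCore.

(** * Numerical constants and conclusion *)

(** For b = 0 the bound is lam d < 0.109597. For b >= 1 both lam d and b log(1 + lam) are at most
    9/100, so (1 + lam)^b <= 100/91, and 9/91 < 11/100. *)
Lemma hc_tdeg_small (R : realType) (b lam d : R) :
  b = 0 \/ 1 <= b -> 0 < lam -> 1 <= d -> lam < hc_c b / d ->
  (1 + lam) `^ b * ln (1 + lam) * d <= 11 / 100.
Proof.
move=> hb lam0 d1; have d0 : 0 < d by lra.
rewrite ltr_pdivlMr // => ld.
have l1 : ln (1 + lam) <= lam by apply: le_ln1Dx; lra.
have ln0 : 0 <= ln (1 + lam) by rewrite ln_ge0 // lerDl ltW.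
set y := ln (1 + lam) in l1 ln0 *; set P := (1 + lam) `^ b.
have PE : P = expR (b * y) by rewrite /P /powR gt_eqF //; lra.
have P0 : 0 < P by rewrite PE expR_gt0.
have yd : y * d <= lam * d by rewrite ler_wpM2r //; lra.
have [b0|b1] := hb.
  move: ld; rewrite /hc_c PE b0 eqxx mul0r expR0; lra.
have b0 : 0 < b by lra.
move: ld; rewrite /hc_c gt_eqF // ltr_pdivlMr // => ld.
have ldb : lam * d <= 9 / 100.
  have : lam * d <= lam * d * b by rewrite ler_peMr // mulr_ge0 //; lra.
  lra.
have by_le : b * y <= 9 / 100.
  have : b * y <= b * lam by rewrite ler_pM2l.
  have : lam * b <= lam * b * d by rewrite ler_peMr // mulr_ge0 //; lra.
  lra.
have P1 : P * (91 / 100) <= 1.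
  have E : P * expR (- (b * y)) = 1 by rewrite PE expRxMexpNx_1.
  rewrite -[leRHS]E ler_pM2l //; have := expR_ge1Dx (- (b * y)); lra.
have : P * (y * d) <= P * (9 / 100) by rewrite ler_pM2l //; lra.
lra.
Qed.

Unset Implicit Arguments.

Theorem theorem1p2 (R : realType) (T : finType) (e : rel T) (b lam : R) :
  simple_graph e ->
  (forall u : T, (0 < deg e u)%N) ->
  (b = 0 \/ 1 <= b) ->
  (forall u : T, mad_induced e R (nbhd e u) <= b) ->
  0 < lam -> lam < hc_c b / (max_deg e)%:R ->
  let D u := (deg e u)%:R * (1 + lam) `^ b * ln (1 + lam) in
  let beta u := (1 + lam) / lam * (D u / (lambertW (D u) * (1 + lambertW (D u)))) in
  let gamma u := (1 + lam) / lam * (D u / ((deg e u)%:R * (1 + lambertW (D u)))) in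
  \sum_(u : T) 1 / (beta u + (deg e u)%:R * gamma u) <= hc_exp_size e lam.
Proof.
move=> [se ie] d0 hb mb lam0 lamD.
pose D u := (deg e u)%:R * (1 + lam) `^ b * ln (1 + lam).
pose beta u := (1 + lam) / lam * (D u / (lambertW (D u) * (1 + lambertW (D u)))).
pose gamma u := (1 + lam) / lam * (D u / ((deg e u)%:R * (1 + lambertW (D u)))).
change (is_true (\sum_u 1 / (beta u + (deg e u)%:R * gamma u) <= hc_exp_size e lam)).
pose t := (1 + lam) `^ b * ln (1 + lam); pose w u := lambertW (D u).
have l1 : 0 < 1 + lam by lra.
have t0 : 0 < t by rewrite mulr_gt0 ?powR_gt0 // ln_gt0 // ltrDl.
have DE u : D u = t * (deg e u)%:R by rewrite /D /t; ring.
have wP u : 0 < w u /\ w u * expR (w u) = t * (deg e u)%:R.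
  by rewrite -DE; apply: lambertWP; rewrite DE mulr_gt0 // ltr0n.
have tE : t = ln (1 + lam) * expR (ln (1 + lam) * b).
  by rewrite /t /powR gt_eqF // mulrC (mulrC b).
have td u : t * (deg e u)%:R <= 11 / 100.
  have du : (0 < max_deg e)%N by apply: leq_trans (d0 u) (leq_bigmax u).
  apply: (@le_trans _ _ (t * (max_deg e)%:R)).
    by rewrite ler_pM2l // ler_nat; apply: (leq_bigmax u).
  by apply: hc_tdeg_small => //; rewrite ler1n.
(* With D = w e^w, the parts D / (w (1 + w)) and D / (1 + w) add up to D / w = e^w. *)
have sumE u : 1 / (beta u + (deg e u)%:R * gamma u) = lam / (1 + lam) * expR (- w u).
  have [w0 wE] := wP u; have du : (deg e u)%:R != 0 :> R by rewrite pnatr_eq0 -lt0n.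
  rewrite /beta /gamma -/(w u) DE -wE expRN.
  have ? := lt0r_neq0 (expR_gt0 (w u)); have ? := lt0r_neq0 w0.
  have ? := lt0r_neq0 l1; have ? := lt0r_neq0 lam0.
  have ? : 1 + w u != 0 by apply: lt0r_neq0; lra.
  field; do ?[apply/andP; split] => //.
  by rewrite lt0r_neq0 // addr_gt0 // !mulr_gt0 ?expR_gt0.
rewrite (eq_bigr _ (fun u _ => sumE u)) -mulr_sumr hc_exp_size_occ //.
rewrite -ler_pdivlMl ?divr_gt0 // invf_div mulr_sumr.
apply: (sum_fixpoint_bound se d0 td) => [u|u|u].
- by apply: ltW; case: (wP u).
- by case: (wP u).
- by rewrite tE; apply: hc_local_bound.
Qed.
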